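(* Let $\lambda$ be a nonzero real number and let $(a_{n,\lambda})_{n\ge0}$, $(b_{n,\lambda})_{n\ge0}$ be sequences of complex numbers. Then $$a_{n,\lambda}=\sum_{k=0}^{n}\binom{n}{k}(1)_{n-k,\lambda}\,b_{k,\lambda}\ \text{ for all } n\ge0$$ if and only if $$b_{n,\lambda}=\sum_{k=0}^{n}\binom{n}{k}(-1)^{n-k}\langle 1\rangle_{n-k,\lambda}\,a_{k,\lambda}\ \text{ for all } n\ge0.$$
   Context: For a nonzero real $\lambda$: $(x)_{0,\lambda}=1$, $(x)_{n,\lambda}=x(x-\lambda)\cdots(x-(n-1)\lambda)$ and $\langle x\rangle_{0,\lambda}=1$, $\langle x\rangle_{n,\lambda}=x(x+\lambda)\cdots(x+(n-1)\lambda)$ for $n\ge1$. *)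

(* Defs.v *)
(* MathComp / MathComp-Analysis: the reals are an arbitrary [R : realType],
   the complex numbers are [R[i]]. *)
From mathcomp Require Import all_boot all_order all_algebra.
From mathcomp Require Import reals complex.

Set Implicit Arguments.
Unset Strict Implicit.
Unset Printing Implicit Defensive.

Import GRing.Theory Num.Theory.

Local Open Scope ring_scope.

Definition degen_falling (R : realType) (lambda x : R) (n : nat) : R :=
  \prod_(i < n) (x - i%:R * lambda).

Definition degen_rising (R : realType) (lambda x : R) (n : nat) : R :=
  \prod_(i < n) (x + i%:R * lambda).

(* Main.v *)
(* The binomial convolution (f, g) |-> sum_k C(n,k) f(n-k) g(k) is associative,
   and (x)_{.,lambda} * (y)_{.,lambda} = (x+y)_{.,lambda} (degenerate
   Vandermonde).  Both follow by induction on n from the fact that the shift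
   f |-> f(. + 1) is a derivation for this product, as for products of
   exponential generating functions.  Since (-1)^n <1>_{n,lambda} =
   (-1)_{n,lambda} and (0)_{.,lambda} is the unit, convolution with
   (1)_{.,lambda} and with (-1)_{.,lambda} are inverse to each other. *)
Require Import Defs.
From mathcomp Require Import all_boot all_order all_algebra.
From mathcomp Require Import reals complex.

Set Implicit Arguments.
Unset Strict Implicit.
Unset Printing Implicit Defensive.

Import GRing.Theory Num.Theory.

Local Open Scope ring_scope.
Local Open Scope complex_scope.

Definition binom_conv (A : comNzRingType) (f g : nat -> A) (n : nat) : A :=
  \sum_(k < n.+1) 'C(n, k)%:R * f (n - k)%N * g k.

(** Any commutative ring is allowed so that the whole argument can run in [R[i]]; the real products
    enter only through the embedding [%:C]. *)
Definition step_falling (A : comNzRingType) (l x : A) (n : nat) : A :=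
  \prod_(i < n) (x - i%:R * l).

Lemma eq_binom_conv (A : comNzRingType) (f f' g g' : nat -> A) :
  f =1 f' -> g =1 g' -> binom_conv f g =1 binom_conv f' g'.
Proof. by move=> ff' gg' n; apply: eq_bigr => k _; rewrite ff' gg'. Qed.

Lemma binom_convDl (A : comNzRingType) (f g h : nat -> A) (n : nat) :
  binom_conv (fun m => f m + g m) h n = binom_conv f h n + binom_conv g h n.
Proof.
by rewrite -big_split; apply: eq_bigr => k _; rewrite mulrDr mulrDl.
Qed.

Lemma binom_convDr (A : comNzRingType) (f g h : nat -> A) (n : nat) :
  binom_conv f (fun m => g m + h m) n = binom_conv f g n + binom_conv f h n.
Proof. by rewrite -big_split; apply: eq_bigr => k _; rewrite mulrDr. Qed.

Lemma binom_convZl (A : comNzRingType) (c : A) (f g : nat -> A) (n : nat) :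
  binom_conv (fun m => c * f m) g n = c * binom_conv f g n.
Proof. by rewrite mulr_sumr; apply: eq_bigr => k _; rewrite !mulrA (mulrC c). Qed.

Lemma binom_convZr (A : comNzRingType) (c : A) (f g : nat -> A) (n : nat) :
  binom_conv f (fun m => c * g m) n = c * binom_conv f g n.
Proof. by rewrite mulr_sumr; apply: eq_bigr => k _; rewrite mulrCA. Qed.

Lemma binom_conv0 (A : comNzRingType) (f g : nat -> A) :
  binom_conv f g 0 = f 0%N * g 0%N.
Proof. by rewrite /binom_conv big_ord1 bin0 mul1r. Qed.

(** Pascal's rule splits each coefficient, which gives the Leibniz rule for the shift. *)
Lemma binom_convS (A : comNzRingType) (f g : nat -> A) (n : nat) :
  binom_conv f g n.+1 =
    binom_conv (fun m => f m.+1) g n + binom_conv f (fun m => g m.+1) n.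
Proof.
rewrite /binom_conv big_ord_recl.
under eq_bigr => i _ do rewrite lift0 binS natrD subSS !mulrDl.
rewrite big_split addrA; congr (_ + _).
(* The top term carries ['C(n, n.+1) = 0]; without it, the sum together with the split-off term
   [k = 0] matches the right-hand side. *)
rewrite [in LHS]big_ord_recr /= (bin_small (ltnSn n)) !mul0r addr0.
rewrite [in RHS]big_ord_recl !bin0 /= !subn0; congr (_ + _).
by apply: eq_bigr => i _; rewrite /bump add1n subnSK.
Qed.

Lemma binom_convA (A : comNzRingType) (f g h : nat -> A) :
  binom_conv (binom_conv f g) h =1 binom_conv f (binom_conv g h).
Proof.
move=> n; elim: n f g h => [|n IHn] f g h; first by rewrite !binom_conv0 mulrA.
rewrite !binom_convS (eq_binom_conv (binom_convS f g) (frefl h)).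
rewrite (eq_binom_conv (frefl f) (binom_convS g h)).
by rewrite binom_convDl binom_convDr !IHn addrA.
Qed.

(** Taking out the first factor, not the last, leaves a coefficient free of [n]: the shift becomes
    multiplication by a constant, at the price of moving [x] to [x - l]. *)
Lemma step_fallingS (A : comNzRingType) (l x : A) (n : nat) :
  step_falling l x n.+1 = x * step_falling l (x - l) n.
Proof.
rewrite /step_falling big_ord_recl mul0r subr0; congr (_ * _).
by apply: eq_bigr => i _; rewrite lift0 -nat1r mulrDl mul1r opprD addrA.
Qed.

(** Shifting either factor leads to the same argument [x + y - l], so the coefficients [x] and [y]
    add up. The induction must therefore range over all [x] and [y]. *)
Lemma step_falling_vandermonde (A : comNzRingType) (l x y : A) :
  binom_conv (step_falling l x) (step_falling l y) =1 step_falling l (x + y).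
Proof.
move=> n; elim: n x y => [|n IHn] x y.
  by rewrite binom_conv0 /step_falling !big_ord0 mulr1.
rewrite binom_convS (eq_binom_conv (step_fallingS l x) (frefl _)).
rewrite (eq_binom_conv (frefl _) (step_fallingS l y)) binom_convZl binom_convZr.
by rewrite !IHn step_fallingS addrAC addrA -mulrDl.
Qed.

(** Shifting the left factor yields the coefficient [0], so only the shift of [f] survives. *)
Lemma binom_conv_step_falling0 (A : comNzRingType) (l : A) (f : nat -> A) :
  binom_conv (step_falling l 0) f =1 f.
Proof.
move=> n; elim: n f => [|n IHn] f.
  by rewrite binom_conv0 /step_falling big_ord0 mul1r.
rewrite binom_convS (eq_binom_conv (step_fallingS l 0) (frefl f)).
by rewrite binom_convZl mul0r add0r IHn.
Qed.

Lemma binom_conv_step_fallingK (A : comNzRingType) (l x : A) (f : nat -> A) :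
  binom_conv (step_falling l (- x)) (binom_conv (step_falling l x) f) =1 f.
Proof.
move=> n; rewrite -binom_convA.
rewrite (eq_binom_conv (step_falling_vandermonde l (- x) x) (frefl f)).
by rewrite addNr binom_conv_step_falling0.
Qed.

Lemma degen_falling_complex (R : realType) (lambda x : R) (n : nat) :
  (degen_falling lambda x n)%:C = step_falling lambda%:C x%:C n.
Proof.
rewrite /degen_falling rmorph_prod; apply: eq_bigr => i _.
by rewrite rmorphB rmorphM rmorph_nat.
Qed.

Lemma degen_rising_sign (R : realType) (lambda x : R) (n : nat) :
  (-1) ^+ n * degen_rising lambda x n = degen_falling lambda (- x) n.
Proof.
elim: n => [|n IHn].
  by rewrite /degen_rising /degen_falling !big_ord0 mulr1.
move: IHn; rewrite /degen_rising /degen_falling !big_ord_recr /= => <-.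
by rewrite exprSr mulrACA mulN1r opprD.
Qed.

Theorem theorem25 (R : realType) (lambda : R) (hlambda : lambda != 0)
    (a b : nat -> R[i]) :
  (forall n : nat,
     a n = \sum_(k < n.+1)
             'C(n, k)%:R * (degen_falling lambda 1 (n - k))%:C * b k)
  <->
  (forall n : nat,
     b n = \sum_(k < n.+1)
             'C(n, k)%:R * (-1) ^+ (n - k)
               * (degen_rising lambda 1 (n - k))%:C * a k).
Proof.
have falling_sum (c : nat -> R[i]) n : \sum_(k < n.+1)
    'C(n, k)%:R * (degen_falling lambda 1 (n - k))%:C * c k =
    binom_conv (step_falling lambda%:C 1) c n.
  by apply: eq_bigr => k _; rewrite degen_falling_complex.
have rising_sum (c : nat -> R[i]) n : \sum_(k < n.+1)
    'C(n, k)%:R * (-1) ^+ (n - k) * (degen_rising lambda 1 (n - k))%:C * c k =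
    binom_conv (step_falling lambda%:C (- 1)) c n.
  apply: eq_bigr => k _; rewrite -(mulrA _%:R); congr (_ * _ * _).
  (* The complex [- 1] becomes the image of the real one, as [degen_falling_complex] requires. *)
  rewrite -[X in step_falling _ X](rmorphN1 (real_complex R)).
  by rewrite -degen_falling_complex -degen_rising_sign rmorphM rmorphXn rmorphN1.
split=> H n.
  have Ha : a =1 binom_conv (step_falling lambda%:C 1) b.
    by move=> m; rewrite H falling_sum.
  by rewrite rising_sum (eq_binom_conv (frefl _) Ha) binom_conv_step_fallingK.
have Hb : b =1 binom_conv (step_falling lambda%:C (- 1)) a.
  by move=> m; rewrite H rising_sum.
rewrite falling_sum (eq_binom_conv (frefl _) Hb).
(* Reading [1] as [- - 1] allows cancellation with [x = - 1]. *)
by rewrite -[X in step_falling _ X]opprK binom_conv_step_fallingK.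
Qed.
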